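(* Let $\mathbb{k}$ be a field containing $\mathbb{Q}$ and let $\mathcal{T}=(A,B,\varepsilon)$ be a commutative triple over $\mathbb{k}$. Then there is an isomorphism of $\mathbb{k}$-vector spaces $$HC^1(A,B,\varepsilon)\cong \mathrm{Der}^1_{\mathbb{k}}(\mathcal{T},A^* ),$$ where $HC^1(A,B,\varepsilon)$ is the first secondary cyclic cohomology associated to the triple and $\mathrm{Der}^1_{\mathbb{k}}(\mathcal{T},A^* )$ is the subspace of those secondary derivations $D\in\mathrm{Der}_{\mathbb{k}}(\mathcal{T},A^* )$ that satisfy $$D(\alpha\otimes b)(a)=-D(\alpha\otimes a)(b)\qquad\text{for all } a,b\in A,\ \alpha\in B.$$
   Context: Conventions: $\mathbb{k}$ is a field containing $\mathbb{Q}$, $\otimes=\otimes_{\mathbb{k}}$, and all $\mathbb{k}$-algebras are associative with unit. Triple: $(A,B,\varepsilon)$ is a triple if $A$ is a $\mathbb{k}$-algebra, $B$ is a commutative $\mathbb{k}$-algebra, and $\varepsilon:B\to A$ is a morphism of $\mathbb{k}$-algebras with $\varepsilon(B)\subseteq\mathcal{Z}(A)$ (the center of $A$). It is a commutative triple if $A$ is also commutative. Secondary Hochschild complex: a cochain complex with terms $\overline{C}^n(A,B,\varepsilon)=\mathrm{Hom}_{\mathbb{k}}(A^{\otimes n+1}\otimes B^{\otimes n(n+1)/2},\mathbb{k})$, $n\ge 0$. In low degree it is $$0\to \mathrm{Hom}_{\mathbb{k}}(A,\mathbb{k})\xrightarrow{\partial^0}\mathrm{Hom}_{\mathbb{k}}(A^{\otimes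 2}\otimes B,\mathbb{k})\xrightarrow{\partial^1}\mathrm{Hom}_{\mathbb{k}}(A^{\otimes 3}\otimes B^{\otimes 3},\mathbb{k})\to\cdots$$ with, for $a,b,c\in A$ and $\alpha,\beta,\gamma\in B$, $$\partial^0 f(a\otimes b\otimes\alpha)=f(a\varepsilon(\alpha)b)-f(b\varepsilon(\alpha)a),$$ $$\partial^1 f(a\otimes b\otimes c\otimes\alpha\otimes\beta\otimes\gamma)=f(a\varepsilon(\alpha)b\otimes c\otimes\beta\gamma)-f(a\otimes b\varepsilon(\gamma)c\otimes\alpha\beta)+f(c\varepsilon(\beta)a\otimes b\otimes\alpha\gamma).$$ Secondary cyclic cohomology: the cyclic group of order $n+1$ with generator $\lambda$ acts on $\overline{C}^n(A,B,\varepsilon)$, and $\overline{C}^n_\lambda(A,B,\varepsilon)=\mathrm{Ker}(1-\lambda)$ is a subcomplex for the maps $\partial^n$; its cohomology is $HC^*(A,B,\varepsilon)$. In degree $0$ the action is trivial, so $\overline{C}^0_\lambda=\mathrm{Hom}_{\mathbb{k}}(A,\mathbb{k})$; in degree $1$ the action is $(\lambda f)(a\otimes b\otimes\alpha)=-f(b\otimes a\otimes\alpha)$, so $\overline{C}^1_\lambda$ consists of the $f\in\mathrm{Hom}_{\mathbb{k}}(A^{\otimes 2}\otimes B,\mathbb{k})$ with $f(a\otimes b\otimes\alpha)=-f(b\otimes a\otimes\alpha)$ for all $a,b\in A$, $\alpha\in B$. Thus $HC^1(A,B,\varepsilon)=\big(\overline{C}^1_\lambda\cap\mathrm{Ker}(\partial^1)\big)/\partial^0(\overline{C}^0_\lambda)$.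 Secondary derivations: let $\mathcal{T}=(A,B,\varepsilon)$ be a commutative triple and $M$ a symmetric $A$-bimodule (equivalently an $A$-module), regarded as a symmetric $B\otimes A$-bimodule via $(\alpha\otimes a)\cdot m=a\varepsilon(\alpha)m=m\,a\varepsilon(\alpha)=m\cdot(\alpha\otimes a)$. A secondary derivation of $\mathcal{T}$ with values in $M$ is a $\mathbb{k}$-linear map $D:B\otimes A\to M$ such that for all $a,b\in A$, $\alpha,\beta\in B$: (1) $D((\alpha\otimes a)(\beta\otimes b))=a\varepsilon(\alpha)D(\beta\otimes b)+D(\alpha\otimes a)b\varepsilon(\beta)$, where $(\alpha\otimes a)(\beta\otimes b)=\alpha\beta\otimes ab$; and (2) $D(\alpha\otimes 1)+D(\alpha\otimes 1)=D(1\otimes\varepsilon(\alpha))$. The set of these is $\mathrm{Der}_{\mathbb{k}}(\mathcal{T},M)$, a $\mathbb{k}$-vector space under pointwise operations. Here $A^*=\mathrm{Hom}_{\mathbb{k}}(A,\mathbb{k})$ is an $A$-module via $(a\cdot\phi)(x)=\phi(xa)$. *)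

(* Defs.v *)
From HB Require Import structures.
From mathcomp Require Import all_boot all_algebra.
From mathcomp Require Import boolp freeg.

Set Implicit Arguments.
Unset Strict Implicit.
Unset Printing Implicit Defensive.

Import GRing.Theory.
Local Open Scope ring_scope.
Local Open Scope quotient_scope.

(* Associative unital algebras, the zero algebra included: MathComp's algType
   has 1 != 0 built in.  Every algType is canonically a kAlgType, see below. *)
HB.mixin Record isKAlgebra (R : pzRingType) A of GRing.Lmodule R A := {
  kone : A;
  kmul : A -> A -> A;
  kmulA : associative kmul;
  kmul1l : left_id kone kmul;
  kmul1r : right_id kone kmul;
  kmulDl : left_distributive kmul +%R;
  kmulDr : right_distributive kmul +%R;
  kscaleAl : forall (c : R) (x y : A), c *: kmul x y = kmul (c *: x) y;
  kscaleAr : forall (c : R) (x y : A), c *: kmul x y = kmul x (c *: y)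
}.

#[short(type="kAlgType")]
HB.structure Definition KAlgebra (R : pzRingType) :=
  {A of GRing.Lmodule R A & isKAlgebra R A}.

HB.instance Definition _ (R : pzRingType) (A : kAlgType R) :=
  GRing.Zmodule_isPzRing.Build (KAlgebra.sort A)
    (@kmulA R A) (@kmul1l R A) (@kmul1r R A) (@kmulDl R A) (@kmulDr R A).

HB.instance Definition _ (R : pzRingType) (A : algType R) :=
  isKAlgebra.Build R (GRing.Algebra.sort A)
    (@mulrA A) (@mul1r A) (@mulr1 A) (@mulrDl A) (@mulrDr A)
    (@scalerAl R A) (@scalerAr R A).

Section KAlgebraTheory.
Variables (R : pzRingType) (A : kAlgType R).

Lemma kalg_scaleAl (c : R) (x y : A) : c *: (x * y) = c *: x * y.
Proof. exact: kscaleAl. Qed.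

Lemma kalg_scaleAr (c : R) (x y : A) : c *: (x * y) = x * (c *: y).
Proof. exact: kscaleAr. Qed.

Fact kmul_linearl (y : A) : linear (fun x : A => x * y).
Proof. by move=> c x x'; rewrite mulrDl -kalg_scaleAl. Qed.

Fact kmul_linearr (x : A) : linear (fun y : A => x * y).
Proof. by move=> c y y'; rewrite mulrDr -kalg_scaleAr. Qed.
End KAlgebraTheory.

Section LinearMaps.
Variables (k : fieldType) (U V : lmodType k).
Implicit Types f g : {linear U -> V}.

HB.instance Definition _ := gen_eqMixin {linear U -> V}.
HB.instance Definition _ := gen_choiceMixin {linear U -> V}.

Lemma lin_ext f g : f =1 g -> f = g.
Proof.
case: f g => [f cf] [g cg] /= /funext fg; case: g / fg cg => cg.
congr GRing.Linear.Pack.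
case: cf cg => [[a1] [s1]] [[a2] [s2]].
by rewrite (Prop_irrelevance a1 a2) (Prop_irrelevance s1 s2).
Qed.

Definition lin (f : U -> V) (fL : linear f) : {linear U -> V} :=
  HB.pack f (GRing.isLinear.Build k U V *:%R f fL).

Definition lin_zero : {linear U -> V} := \0.
Definition lin_opp f : {linear U -> V} := \- f.
Definition lin_add f g : {linear U -> V} := f \+ g.
Definition lin_scale c f : {linear U -> V} := c \*: f.

Fact lin_addA : associative lin_add.
Proof. by move=> f g h; apply: lin_ext => x /=; rewrite addrA. Qed.
Fact lin_addC : commutative lin_add.
Proof. by move=> f g; apply: lin_ext => x /=; rewrite addrC. Qed.
Fact lin_add0 : left_id lin_zero lin_add.
Proof. by move=> f; apply: lin_ext => x /=; rewrite add0r. Qed.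
Fact lin_addN : left_inverse lin_zero lin_opp lin_add.
Proof. by move=> f; apply: lin_ext => x /=; rewrite addNr. Qed.

HB.instance Definition _ := GRing.isZmodule.Build {linear U -> V}
  lin_addA lin_addC lin_add0 lin_addN.

Fact lin_scaleA a b f : lin_scale a (lin_scale b f) = lin_scale (a * b) f.
Proof. by apply: lin_ext => x /=; rewrite scalerA. Qed.
Fact lin_scale1 : left_id 1 lin_scale.
Proof. by move=> f; apply: lin_ext => x /=; rewrite scale1r. Qed.
Fact lin_scaleDr : right_distributive lin_scale +%R.
Proof. by move=> a f g; apply: lin_ext => x /=; rewrite scalerDr. Qed.
Fact lin_scaleDl f : {morph lin_scale^~ f : a b / a + b}.
Proof. by move=> a b; apply: lin_ext => x /=; rewrite scalerDl. Qed.

HB.instance Definition _ := GRing.Zmodule_isLmodule.Build k {linear U -> V}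
  lin_scaleA lin_scale1 lin_scaleDr lin_scaleDl.

Lemma lin0E x : (0 : {linear U -> V}) x = 0. Proof. by []. Qed.
Lemma linNE f x : (- f) x = - f x. Proof. by []. Qed.
Lemma linDE f g x : (f + g) x = f x + g x. Proof. by []. Qed.
Lemma linZE c f x : (c *: f) x = c *: f x. Proof. by []. Qed.
End LinearMaps.

Section Subspaces.
Variables (k : fieldType) (V : lmodType k).

(* Linear subspaces as Prop-valued predicates; membership is made boolean
   classically so that the library's subtype and quotient constructions apply. *)
Record subspace := Subspace {
  in_subspace :> V -> Prop;
  subspace0 : in_subspace 0;
  subspaceP : forall (c : k) (u v : V),
    in_subspace u -> in_subspace v -> in_subspace (c *: u + v)
}.

Definition subspace_pred (S : subspace) : {pred V} := fun x => `[< S x >].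

Fact subspace_pred_closed (S : subspace) :
  GRing.subsemimod_closed (subspace_pred S).
Proof.
apply: GRing.submod_closed_semi; split; first exact/asboolP/subspace0.
by move=> c u v /asboolP Su /asboolP Sv; apply/asboolP/subspaceP.
Qed.

HB.instance Definition _ (S : subspace) :=
  GRing.isSubmodClosed.Build k V (subspace_pred S) (subspace_pred_closed S).

Definition submodule (S : subspace) : Type := {x : V | subspace_pred S x}.

HB.instance Definition _ (S : subspace) := SubChoice.on (submodule S).
HB.instance Definition _ (S : subspace) :=
  [SubChoice_isSubLmodule of submodule S by <:].

Definition incl (S : subspace) : {linear submodule S -> V} := val.
Arguments incl {S}.

Lemma inclP (S : subspace) (x : submodule S) : S (incl x).
Proof. by apply/asboolP; case: x. Qed.

Lemma incl_inj (S : subspace) : injective (incl : submodule S -> V).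
Proof. exact: val_inj. Qed.

Lemma incl_surj (S : subspace) x : S x -> exists y : submodule S, incl y = x.
Proof. by move=> /asboolP Sx; exists (exist _ x Sx). Qed.

Definition quotient_space (S : subspace) : Type :=
  Quotient.quot (subspace_pred S).

Section Quotient.
Variable S : subspace.

HB.instance Definition _ := GRing.Zmodule.on (quotient_space S).

Let pr (x : V) : quotient_space S := \pi_(Quotient.quot (subspace_pred S)) x.

Let prP x y : pr x = pr y <-> S (x - y).
Proof.
by split=> [/eqP|xy]; [|apply/eqP]; rewrite -Quotient.idealrBE;
   [move/asboolP|exact/asboolP].
Qed.

Let prD x y : pr (x + y) = pr x + pr y.
Proof. exact: (Quotient.pi_add (subspace_pred S)). Qed.

Let pr_surj (q : quotient_space S) : exists x, q = pr x.
Proof. by exists (repr q); rewrite /pr reprK. Qed.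

Definition quotient_scale (c : k) (q : quotient_space S) : quotient_space S :=
  pr (c *: repr q).

Let prZ c x : quotient_scale c (pr x) = pr (c *: x).
Proof.
apply/prP; rewrite -scalerBr -[_ *: _]addr0; apply: subspaceP (subspace0 S).
by apply/prP; rewrite /pr reprK.
Qed.

Fact quotient_scaleA a b q :
  quotient_scale a (quotient_scale b q) = quotient_scale (a * b) q.
Proof. by have [x ->] := pr_surj q; rewrite !prZ scalerA. Qed.
Fact quotient_scale1 : left_id 1 quotient_scale.
Proof. by move=> q; have [x ->] := pr_surj q; rewrite prZ scale1r. Qed.
Fact quotient_scaleDr : right_distributive quotient_scale +%R.
Proof.
move=> a p q; have [[x ->] [y ->]] := (pr_surj p, pr_surj q).
by rewrite -prD !prZ scalerDr prD.
Qed.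
Fact quotient_scaleDl q : {morph quotient_scale^~ q : a b / a + b}.
Proof.
by move=> a b; have [x ->] := pr_surj q; rewrite !prZ scalerDl prD.
Qed.

HB.instance Definition _ :=
  GRing.Zmodule_isLmodule.Build k (quotient_space S)
    quotient_scaleA quotient_scale1 quotient_scaleDr quotient_scaleDl.

Fact proj_linear : linear pr.
Proof. by move=> c x y; rewrite prD -prZ. Qed.

Definition proj : {linear V -> quotient_space S} := lin proj_linear.

Lemma projP x y : proj x = proj y <-> S (x - y).
Proof. exact: prP. Qed.

Lemma proj_surj q : exists x, q = proj x.
Proof. exact: pr_surj. Qed.

Section Lift.
Variables (W : lmodType k) (f : {linear V -> W}).
Hypothesis fS : forall x, S x -> f x = 0.

Let repr_projE x : f (repr (proj x)) = f x.
Proof.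
apply/eqP; rewrite -subr_eq0 -raddfB /=; apply/eqP/fS/projP.
by rewrite /proj /= /pr reprK.
Qed.

Fact quotient_lift_linear : linear (fun q : quotient_space S => f (repr q)).
Proof.
move=> c p q; have [[x ->] [y ->]] := (proj_surj p, proj_surj q).
by rewrite -linearP !repr_projE linearP.
Qed.

Definition quotient_lift : {linear quotient_space S -> W} :=
  lin quotient_lift_linear.

Lemma quotient_liftE x : quotient_lift (proj x) = f x.
Proof. exact: repr_projE. Qed.
End Lift.
End Quotient.

Definition span (X : V -> Prop) : subspace.
Proof.
exists (fun x => forall S : subspace, (forall y, X y -> S y) -> S x).
- by move=> S _; exact: subspace0.
- by move=> c u v Xu Xv S XS; apply: subspaceP; [exact: Xu|exact: Xv].
Defined.
End Subspaces.
Arguments incl {k V S}.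

Section FreeModule.
Variables (k : fieldType) (X : choiceType) (W : lmodType k) (f : X -> W).

Fact fglift_linear : linear (fglift f : {freeg X / k} -> W).
Proof.
pose g : {additive {freeg X / k} -> W} :=
  HB.pack (fglift f) (GRing.isZmodMorphism.Build _ _ _ (lift_is_additive f)).
move=> c x y; rewrite -[fglift f]/(g : _ -> W) raddfD; congr (_ + _).
rewrite -[c *: x]/(\sum_(z <- dom x) << c * coeff z x *g z >>).
rewrite -[in RHS](freeg_sumE x) !raddf_sum.
by apply: eq_bigr => z _; rewrite /= !liftU scalerA.
Qed.

Definition free_lift : {linear {freeg X / k} -> W} := lin fglift_linear.

Lemma free_liftE x : free_lift << x >> = f x.
Proof. by rewrite /free_lift /= liftU scale1r. Qed.
End FreeModule.

Section Tensor.
Variables (k : fieldType) (U V : lmodType k).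

(* U ⊗ V is the free space on U * V modulo bilinearity; its universal property
   is tensor_lift / tensor_liftE / tensor_ext below. *)
Variant tensor_rel : {freeg (U * V)%type / k} -> Prop :=
| TensorRelL c u u' v :
    tensor_rel (<< (c *: u + u', v) >> - (c *: << (u, v) >> + << (u', v) >>))
| TensorRelR c u v v' :
    tensor_rel (<< (u, c *: v + v') >> - (c *: << (u, v) >> + << (u, v') >>)).

Definition tensor : lmodType k := quotient_space (span tensor_rel).

Definition pure (u : U) (v : V) : tensor := proj _ << (u, v) >>.

Fact pure_linearl v : linear (pure^~ v).
Proof.
move=> c u u'; rewrite /pure -linearP; apply/projP => S; apply.
exact: TensorRelL.
Qed.

Fact pure_linearr u : linear (pure u).
Proof.
move=> c v v'; rewrite /pure -linearP; apply/projP => S; apply.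
exact: TensorRelR.
Qed.

Section Lift.
Variables (W : lmodType k) (f : {linear U -> {linear V -> W}}).

Let g := free_lift (fun uv : U * V => f uv.1 uv.2).

Fact tensor_lift_subproof x : span tensor_rel x -> g x = 0.
Proof.
have ker0 : g 0 = 0 by rewrite linear0.
have kerP c u v : g u = 0 -> g v = 0 -> g (c *: u + v) = 0.
  by move=> gu gv; rewrite linearP gu gv scaler0 addr0.
have relP y : tensor_rel y -> g y = 0.
  case=> c *; rewrite linearB linearP /g !free_liftE /= linearP.
    by rewrite linDE linZE subrr.
  by rewrite subrr.
by move=> spx; exact: (spx (Subspace ker0 kerP)).
Qed.

Definition tensor_lift : {linear tensor -> W} :=
  quotient_lift tensor_lift_subproof.

Lemma tensor_liftE u v : tensor_lift (pure u v) = f u v.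
Proof. by rewrite /tensor_lift /pure quotient_liftE /g free_liftE. Qed.
End Lift.

Lemma tensor_ext (W : lmodType k) (f g : {linear tensor -> W}) :
  (forall u v, f (pure u v) = g (pure u v)) -> f = g.
Proof.
move=> fg; apply: lin_ext => t; have [x ->] := proj_surj t.
have -> : proj (span tensor_rel) x =
    \sum_(z <- dom x) coeff z x *: pure z.1 z.2.
  rewrite -[in LHS](freeg_sumE x) raddf_sum; apply: eq_bigr => -[u v] _.
  rewrite -linearZ; congr (proj _ _); apply/eqP/freeg_eqP => z.
  by rewrite coeffZ !coeffU mul1r.
by rewrite !linear_sum; apply: eq_bigr => z _; rewrite !linearZ; congr (_ *: _).
Qed.
End Tensor.

Notation "U ⊗ V" := (tensor U V) (at level 40, left associativity).
Notation "u ⊗ₜ v" := (pure u v) (at level 40, left associativity).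

Section Trilinear.
Variables (k : fieldType) (U V W X : lmodType k).

Record trilinear (F : U -> V -> W -> X) : Prop := Trilinear {
  trilinear1 : forall v w, linear (fun u => F u v w);
  trilinear2 : forall u w, linear (fun v => F u v w);
  trilinear3 : forall u v, linear (fun w => F u v w)
}.

Variables (F : U -> V -> W -> X) (FP : trilinear F).

Let F3 u v : {linear W -> X} := lin (trilinear3 FP u v).

Fact trilinear_sub2 u : linear (F3 u).
Proof. by move=> c v v'; apply: lin_ext => w; exact: trilinear2. Qed.

Let F2 u : {linear V -> {linear W -> X}} := lin (trilinear_sub2 u).

Fact trilinear_sub1 : linear F2.
Proof.
by move=> c u u'; apply: lin_ext => v; apply: lin_ext => w; exact: trilinear1.
Qed.

Definition trilinear_lift : {linear U ⊗ V ⊗ W -> X} :=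
  tensor_lift (tensor_lift (lin trilinear_sub1)).

Lemma trilinear_liftE u v w : trilinear_lift (u ⊗ₜ v ⊗ₜ w) = F u v w.
Proof. by rewrite /trilinear_lift !tensor_liftE. Qed.
End Trilinear.

Lemma trilinear_ext (k : fieldType) (U V W X : lmodType k)
    (f g : {linear U ⊗ V ⊗ W -> X}) :
  (forall u v w, f (u ⊗ₜ v ⊗ₜ w) = g (u ⊗ₜ v ⊗ₜ w)) -> f = g.
Proof.
move=> fg; apply: tensor_ext => t w.
pose h (e : {linear U ⊗ V ⊗ W -> X}) : {linear U ⊗ V -> X} :=
  e \o lin (@pure_linearl k (U ⊗ V) W w).
suff /(congr1 (fun e : {linear U ⊗ V -> X} => e t)) : h f = h g by [].
by apply: tensor_ext => u v; exact: fg.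
Qed.

Lemma trilinear2_ext (k : fieldType) (U V W U' V' W' X : lmodType k)
    (f g : {linear (U ⊗ V ⊗ W) ⊗ (U' ⊗ V' ⊗ W') -> X}) :
  (forall u v w u' v' w',
    f ((u ⊗ₜ v ⊗ₜ w) ⊗ₜ (u' ⊗ₜ v' ⊗ₜ w')) =
    g ((u ⊗ₜ v ⊗ₜ w) ⊗ₜ (u' ⊗ₜ v' ⊗ₜ w'))) -> f = g.
Proof.
move=> fg; apply: tensor_ext => x y.
pose l (e : {linear (U ⊗ V ⊗ W) ⊗ (U' ⊗ V' ⊗ W') -> X}) t :
  {linear U ⊗ V ⊗ W -> X} := e \o lin (@pure_linearl k _ (U' ⊗ V' ⊗ W') t).
pose r (e : {linear (U ⊗ V ⊗ W) ⊗ (U' ⊗ V' ⊗ W') -> X}) t :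
  {linear U' ⊗ V' ⊗ W' -> X} := e \o lin (@pure_linearr k (U ⊗ V ⊗ W) _ t).
suff /(congr1 (fun e : {linear _ -> X} => e x)) : l f y = l g y by [].
apply: trilinear_ext => u v w; pose t := u ⊗ₜ v ⊗ₜ w.
suff /(congr1 (fun e : {linear _ -> X} => e y)) : r f t = r g t by [].
by apply: trilinear_ext => u' v' w'; exact: fg.
Qed.

Record triple (k : fieldType) := Triple {
  algA : kAlgType k;
  algB : kAlgType k;
  mulB_comm : commutative (@GRing.mul algB);
  eps : {rmorphism algB -> algA};
  eps_scalable : scalable eps;
  eps_central : forall (x : algB) (a : algA), eps x * a = a * eps x
}.
Arguments eps {k t}.

Definition commutative_triple (k : fieldType) (T : triple k) :=
  commutative (@GRing.mul (algA T)).

Section LinearClosure.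
Variables (k : fieldType) (U V W : lmodType k).
Implicit Types (f g : U -> V).

Fact linear_compF (h : {linear V -> W}) f : linear f -> linear (fun x => h (f x)).
Proof. by move=> fL c x y; rewrite fL linearP. Qed.

Fact linear_addF f g : linear f -> linear g -> linear (fun x => f x + g x).
Proof. by move=> fL gL c x y; rewrite fL gL scalerDr addrACA. Qed.

Fact linear_oppF f : linear f -> linear (fun x => - f x).
Proof. by move=> fL c x y; rewrite fL opprD scalerN. Qed.

Fact linear_purelF (X : lmodType k) (w : X) f :
  linear f -> linear (fun x => f x ⊗ₜ w).
Proof. by move=> fL c x y; rewrite fL pure_linearl. Qed.

Fact linear_purerF (X : lmodType k) (w : X) f :
  linear f -> linear (fun x => w ⊗ₜ f x).
Proof. by move=> fL c x y; rewrite fL pure_linearr. Qed.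
End LinearClosure.

Fact linear_idF (k : fieldType) (U : lmodType k) : linear (fun x : U => x).
Proof. by []. Qed.

Section LinearClosureAlgebra.
Variables (k : fieldType) (U : lmodType k) (A : kAlgType k) (f : U -> A).

Fact linear_mullF y : linear f -> linear (fun x => f x * y).
Proof. by move=> fL c u v; rewrite fL kmul_linearl. Qed.

Fact linear_mulrF x : linear f -> linear (fun y => x * f y).
Proof. by move=> fL c u v; rewrite fL kmul_linearr. Qed.
End LinearClosureAlgebra.

Fact linear_epsF (k : fieldType) (U : lmodType k) (T : triple k)
  (f : U -> algB T) : linear f -> linear (fun x => eps (f x)).
Proof. by move=> fL c u v; rewrite fL raddfD /= eps_scalable. Qed.

Ltac prove_linear := repeat first
  [ exact: linear_idF | apply: linear_addF | apply: linear_oppF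
  | apply: linear_mullF | apply: linear_mulrF | apply: linear_epsF
  | apply: linear_purelF | apply: linear_purerF | apply: linear_compF ].

Section SecondaryComplex.
Variables (k : fieldType) (T : triple k).
Local Notation A := (algA T).
Local Notation B := (algB T).
Implicit Types (a b c : A) (α β γ : B).

Definition cochain0 : lmodType k := {linear A -> k^o}.
Definition cochain1 : lmodType k := {linear A ⊗ A ⊗ B -> k^o}.
Definition cochain2 : lmodType k :=
  {linear (A ⊗ A ⊗ A) ⊗ (B ⊗ B ⊗ B) -> k^o}.

Section Operators.

Fact d0_trilinear (f : cochain0) :
  trilinear (fun a b α => f (a * eps α * b) - f (b * eps α * a)).
Proof. split=> *; prove_linear. Qed.

Fact d0_linear : linear (fun f => trilinear_lift (d0_trilinear f)).
Proof.
move=> s f g; apply: trilinear_ext => a b α.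
by rewrite linDE linZE !trilinear_liftE !linDE !linZE scalerBr addrACA opprD.
Qed.

Definition d0 : {linear cochain0 -> cochain1} := lin d0_linear.

Lemma d0E (f : cochain0) a b α :
  d0 f (a ⊗ₜ b ⊗ₜ α) = f (a * eps α * b) - f (b * eps α * a).
Proof. exact: trilinear_liftE. Qed.

Definition d1_formula (f : cochain1) a b c α β γ : k^o :=
  f ((a * eps α * b) ⊗ₜ c ⊗ₜ (β * γ)) - f (a ⊗ₜ (b * eps γ * c) ⊗ₜ (α * β))
  + f ((c * eps β * a) ⊗ₜ b ⊗ₜ (α * γ)).

Fact d1_trilinearB (f : cochain1) a b c : trilinear (d1_formula f a b c).
Proof. by split=> *; rewrite /d1_formula; prove_linear. Qed.

Fact d1_trilinearA (f : cochain1) :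
  trilinear (fun a b c => trilinear_lift (d1_trilinearB f a b c)).
Proof.
have d1L α β γ : trilinear (fun a b c => d1_formula f a b c α β γ).
  by split=> *; rewrite /d1_formula; prove_linear.
by split=> x y s u v; apply: trilinear_ext => α β γ;
   rewrite linDE linZE !trilinear_liftE; have [L1 L2 L3] := d1L α β γ;
   first [exact: L1 | exact: L2 | exact: L3].
Qed.

Let d1_fun (f : cochain1) : cochain2 :=
  tensor_lift (trilinear_lift (d1_trilinearA f)).

Let d1_funE f a b c α β γ :
  d1_fun f ((a ⊗ₜ b ⊗ₜ c) ⊗ₜ (α ⊗ₜ β ⊗ₜ γ)) = d1_formula f a b c α β γ.
Proof. by rewrite [LHS]tensor_liftE !trilinear_liftE. Qed.

Fact d1_linear : linear d1_fun.
Proof.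
move=> s f g; apply: trilinear2_ext => a b c α β γ.
rewrite linDE linZE !d1_funE /d1_formula !(linDE, linZE).
by rewrite !scalerDr scalerN opprD [X in X + _ = _]addrACA [LHS]addrACA.
Qed.

Definition d1 : {linear cochain1 -> cochain2} := lin d1_linear.

Lemma d1E (f : cochain1) a b c α β γ :
  d1 f ((a ⊗ₜ b ⊗ₜ c) ⊗ₜ (α ⊗ₜ β ⊗ₜ γ)) =
    f ((a * eps α * b) ⊗ₜ c ⊗ₜ (β * γ)) - f (a ⊗ₜ (b * eps γ * c) ⊗ₜ (α * β))
    + f ((c * eps β * a) ⊗ₜ b ⊗ₜ (α * γ)).
Proof. exact: d1_funE. Qed.

Fact cyc1_trilinear (f : cochain1) : trilinear (fun a b α => - f (b ⊗ₜ a ⊗ₜ α)).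
Proof. by split=> *; prove_linear. Qed.

Fact cyc1_linear : linear (fun f => trilinear_lift (cyc1_trilinear f)).
Proof.
move=> s f g; apply: trilinear_ext => a b α.
by rewrite linDE linZE !trilinear_liftE linDE linZE opprD scalerN.
Qed.

Definition cyc1 : {linear cochain1 -> cochain1} := lin cyc1_linear.

Lemma cyc1E (f : cochain1) a b α :
  cyc1 f (a ⊗ₜ b ⊗ₜ α) = - f (b ⊗ₜ a ⊗ₜ α).
Proof. exact: trilinear_liftE. Qed.
End Operators.

(* Ker (1 - λ) ∩ Ker ∂^1, with λ = cyc1. *)
Definition cyclic_cocycle1 : subspace cochain1.
Proof.
exists (fun f => f - cyc1 f = 0 /\ d1 f = 0).
- by split; rewrite linear0 ?subrr.
- move=> s f g [f1 f2] [g1 g2]; split; last by rewrite linearP f2 g2 scaler0 addr0.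
  by rewrite linearP opprD addrACA -scalerBr f1 g1 scaler0 addr0.
Defined.

Lemma d0_cyclic_cocycle1 (h : cochain0) : cyclic_cocycle1 (d0 h).
Proof.
split.
  apply/eqP; rewrite subr_eq0; apply/eqP; apply: trilinear_ext => a b α.
  by rewrite cyc1E !d0E opprB.
apply: trilinear2_ext => a b c α β γ; rewrite d1E !d0E !rmorphM /=.
have epsAC x (y : A) z : z * eps x * y = z * y * eps x.
  by rewrite -!mulrA eps_central.
have -> : a * eps α * b * (eps β * eps γ) * c =
    a * (eps α * eps β) * (b * eps γ * c).
  by rewrite !mulrA !(epsAC _ b) !(epsAC _ c).
have -> : c * (eps β * eps γ) * (a * eps α * b) =
    c * eps β * a * (eps α * eps γ) * b.
  by rewrite !mulrA !(epsAC _ a) !(epsAC _ b) (epsAC γ (eps α)).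
have -> : b * (eps α * eps γ) * (c * eps β * a) =
    b * eps γ * c * (eps α * eps β) * a.
  by rewrite !mulrA !(epsAC _ c) !(epsAC _ a) (epsAC α (eps γ)).
by rewrite opprB [X in X + _ = _]addrC !addrA subrK subrK subrr.
Qed.

Definition cyclic_cocycles1 : lmodType k := submodule cyclic_cocycle1.

(* The image of ∂^0, which lies in cyclic_cocycle1 by d0_cyclic_cocycle1; the
   cyclic 0-cochains are all of cochain0, as λ acts trivially in degree 0. *)
Definition cyclic_coboundary1 : subspace cyclic_cocycles1.
Proof.
exists (fun f => exists h : cochain0, incl f = d0 h).
- by exists 0; rewrite !linear0.
- by move=> s f g [u fu] [v gv]; exists (s *: u + v); rewrite !linearP fu gv.
Defined.

Definition HC1 : lmodType k := quotient_space cyclic_coboundary1.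
End SecondaryComplex.

(* A left module; over a commutative algebra, also a symmetric bimodule with
   m · a = a · m. *)
Record amodule (k : fieldType) (A : kAlgType k) := AModule {
  amod_sort :> lmodType k;
  act : A -> amod_sort -> amod_sort;
  act_linearl : forall m, linear (act^~ m);
  act_linearr : forall a, linear (act a);
  act1 : forall m, act 1 m = m;
  actM : forall a b m, act (a * b) m = act a (act b m)
}.

Section Dual.
Variables (k : fieldType) (A : kAlgType k).

Definition dual_act (a : A) (phi : {linear A -> k^o}) : {linear A -> k^o} :=
  lin (linear_compF phi (linear_mullF a (@linear_idF k A))).

Lemma dual_actE a phi x : dual_act a phi x = phi (x * a).
Proof. by []. Qed.

Definition dual : amodule A.
Proof.
refine (@AModule k A {linear A -> k^o} dual_act _ _ _ _).
- move=> phi s a b; apply: lin_ext => x.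
  by rewrite linDE linZE !dual_actE kmul_linearr linearP.
- by move=> a s phi psi; apply: lin_ext.
- by move=> phi; apply: lin_ext => x; rewrite dual_actE mulr1.
- by move=> a b phi; apply: lin_ext => x; rewrite !dual_actE mulrA.
Defined.
End Dual.

Section SecondaryDerivations.
Variables (k : fieldType) (T : triple k).
Local Notation A := (algA T).
Local Notation B := (algB T).

Section Derivations.
Variable M : amodule A.

(* Meant for commutative triples: the right action D(α ⊗ a) · (b ε(β)) of the
   symmetric bimodule M is written as the left action of b ε(β). *)
Record secondary_derivation (D : {linear B ⊗ A -> M}) : Prop := {
  secder_mul : forall (a b : A) (α β : B),
    D ((α * β) ⊗ₜ (a * b)) =
      act (a * eps α) (D (β ⊗ₜ b)) + act (b * eps β) (D (α ⊗ₜ a));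
  secder_eps : forall α : B,
    D (α ⊗ₜ (1 : A)) + D (α ⊗ₜ (1 : A)) = D ((1 : B) ⊗ₜ eps α)
}.

Definition Der_subspace : subspace {linear B ⊗ A -> M}.
Proof.
exists secondary_derivation.
- split=> [a b α β|α]; rewrite !lin0E ?addr0 //.
  have act0 x : act x (0 : M) = 0.
    have := act_linearr x (-1) (0 : M) 0.
    by rewrite scaler0 addr0 scaleN1r addNr.
  by rewrite !act0 addr0.
- move=> s D E [D1 D2] [E1 E2]; split=> [a b α β|α]; rewrite !linDE !linZE.
    by rewrite D1 E1 !act_linearr scalerDr addrACA.
  by rewrite -D2 -E2 scalerDr addrACA.
Defined.

Definition Der : lmodType k := submodule Der_subspace.

Definition Der_fun : {linear Der -> {linear B ⊗ A -> M}} := incl.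
End Derivations.
Arguments Der_fun {M}.

Definition Der1_subspace : subspace (Der (dual A)).
Proof.
exists (fun D : Der (dual A) => forall (a b : A) (α : B),
  (Der_fun D (α ⊗ₜ b) : {linear A -> k^o}) a =
  - (Der_fun D (α ⊗ₜ a) : {linear A -> k^o}) b).
- by move=> a b α; rewrite linear0 oppr0.
- move=> s D E DP EP a b α; pose ev (F : Der (dual A)) x y : k^o :=
    (Der_fun F (α ⊗ₜ x) : {linear A -> k^o}) y.
  have evP x y : ev (s *: D + E) x y = s *: ev D x y + ev E x y.
    by rewrite /ev linearP.
  rewrite -/(ev _ b a) -/(ev _ a b) !evP opprD -scalerN.
  by congr (_ *: _ + _); [exact: DP|exact: EP].
Defined.

Definition Der1 : lmodType k := submodule Der1_subspace.
End SecondaryDerivations.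
Arguments Der_fun {k T M}.

(* Main.v *)
Require Import Defs.
From mathcomp Require Import all_boot all_algebra.
From mathcomp Require Import boolp.

Set Implicit Arguments.
Unset Strict Implicit.
Unset Printing Implicit Defensive.

Import GRing.Theory.
Local Open Scope ring_scope.

(* The isomorphism sends a cyclic cocycle f to the map D with
   D(α ⊗ a)(x) = f(x ⊗ a ⊗ α).  As A is commutative, ∂^0 vanishes, so
   HC^1 is the space of cyclic 1-cocycles itself.  The cocycle identity at
   γ = 1 is the Leibniz rule for D, and at α = β = 1, b = c = 1 it is
   2 D(γ ⊗ 1) = D(1 ⊗ ε(γ)).  Conversely, splitting off the factors γ ⊗ 1 and
   1 ⊗ ε(γ) by the Leibniz rule, these two special cases imply the full
   cocycle identity.  Cyclicity of f is literally the antisymmetry of D. *)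

Lemma inj_surj_bij (X Y : Type) (f : X -> Y) :
  injective f -> (forall y, exists x, f x = y) -> bijective f.
Proof.
move=> f_inj /choice[g gK]; exists g => // x.
by apply: f_inj; rewrite gK.
Qed.

Section Corestriction.
Variables (k : fieldType) (U V : lmodType k) (S : subspace V).
Variables (f : {linear U -> V}) (fS : forall u, S (f u)).

Let corestrict_fun u : submodule S := exist _ (f u) (asboolT (fS u)).

Fact corestrict_linear : linear corestrict_fun.
Proof. by move=> c u v; apply: incl_inj; rewrite linearP /= linearP. Qed.

Definition corestrict : {linear U -> submodule S} := lin corestrict_linear.

Lemma incl_corestrict u : incl (corestrict u) = f u.
Proof. by []. Qed.
End Corestriction.

(** Injectivity of [f] and [fS] together force [S] to be zero. This is the situation of [HC1], where
    the coboundaries vanish. *)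
Lemma quotient_lift_bij (k : fieldType) (V W : lmodType k) (S : subspace V)
    (f : {linear V -> W}) (fS : forall x, S x -> f x = 0) :
  injective f -> (forall w, exists v, f v = w) -> bijective (quotient_lift fS).
Proof.
move=> f_inj f_surj; apply: inj_surj_bij => [p q|w].
  have [[x ->] [y ->]] := (proj_surj p, proj_surj q).
  by rewrite !quotient_liftE => /f_inj ->.
by have [v <-] := f_surj w; exists (proj S v); rewrite quotient_liftE.
Qed.

Section Currying.
Variables (k : fieldType) (T : triple k).
Local Notation A := (algA T).
Local Notation B := (algB T).

Section Curry.
Variable f : cochain1 T.

(** Linearity is built from the inside out: [x] is the argument of the functional in [dual A], so it
    comes last in the curried order [α], [a], [x]. *)
Fact curry_linear3 (α : B) (a : A) : linear (fun x : A => f (x ⊗ₜ a ⊗ₜ α)).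
Proof. by prove_linear. Qed.

Fact curry_linear2 (α : B) :
  linear (fun a : A => lin (curry_linear3 α a) : dual A).
Proof.
move=> c a b; apply: lin_ext => x; rewrite linDE linZE /=.
by rewrite pure_linearr pure_linearl linearP.
Qed.

Fact curry_linear1 :
  linear (fun α : B => lin (curry_linear2 α) : {linear A -> dual A}).
Proof.
move=> c α β; apply: lin_ext => a; apply: lin_ext => x.
by rewrite !(linDE, linZE) /= pure_linearr linearP.
Qed.

Definition curry_fun : {linear B ⊗ A -> dual A} :=
  tensor_lift (lin curry_linear1).

Lemma curry_funE (α : B) (a x : A) :
  (curry_fun (α ⊗ₜ a) : {linear A -> k^o}) x = f (x ⊗ₜ a ⊗ₜ α).
Proof. by rewrite /curry_fun tensor_liftE. Qed.
End Curry.

Fact curry_linear : linear curry_fun.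
Proof.
move=> c f g; apply: tensor_ext => α a; apply: lin_ext => x.
by rewrite !(linDE, linZE) !curry_funE.
Qed.

Definition curry : {linear cochain1 T -> {linear B ⊗ A -> dual A}} :=
  lin curry_linear.

Lemma curryE f (α : B) (a x : A) :
  (curry f (α ⊗ₜ a) : {linear A -> k^o}) x = f (x ⊗ₜ a ⊗ₜ α).
Proof. exact: curry_funE. Qed.

Lemma curry_inj : injective curry.
Proof.
move=> f g fg; apply: trilinear_ext => x a α.
by rewrite -!curryE fg.
Qed.

Section Uncurry.
Variable D : {linear B ⊗ A -> dual A}.

Fact uncurry_trilinear : trilinear
  (fun (x a : A) (α : B) => (D (α ⊗ₜ a) : {linear A -> k^o}) x : k^o).
Proof.
split=> [a α c x y|x α c a b|x a c α β]; first by rewrite linearP.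
  by rewrite pure_linearr linearP.
by rewrite pure_linearl linearP.
Qed.

Definition uncurry : cochain1 T := trilinear_lift uncurry_trilinear.

Lemma uncurryE (x a : A) (α : B) :
  uncurry (x ⊗ₜ a ⊗ₜ α) = (D (α ⊗ₜ a) : {linear A -> k^o}) x.
Proof. exact: trilinear_liftE. Qed.

Lemma uncurryK : curry uncurry = D.
Proof.
by apply: tensor_ext => α a; apply: lin_ext => x; rewrite curryE uncurryE.
Qed.
End Uncurry.

(** On pure tensors, lying in Ker(1 - λ) is exactly the antisymmetry that [Der1_subspace] demands of
    [curry f]. *)
Lemma cyc1_fixedP (f : cochain1 T) :
  f - cyc1 T f = 0 <->
  forall (a b : A) (α : B), f (a ⊗ₜ b ⊗ₜ α) = - f (b ⊗ₜ a ⊗ₜ α).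
Proof.
split=> [/eqP|fN].
  by rewrite subr_eq0 => /eqP fE a b α; rewrite [in LHS]fE cyc1E.
by apply/eqP; rewrite subr_eq0; apply/eqP/trilinear_ext => a b α; rewrite cyc1E.
Qed.

Hypothesis commT : commutative_triple T.

Lemma d0_comm (h : cochain0 T) : d0 T h = 0.
Proof.
apply: trilinear_ext => a b α; rewrite d0E lin0E.
by rewrite commT [a * _]commT mulrA subrr.
Qed.

Lemma curry_secondary_derivation (f : cochain1 T) :
  d1 T f = 0 -> secondary_derivation (curry f).
Proof.
move=> f0.
(* The cocycle identity solved for its middle term, the one that becomes [D] of a product. *)
have f1 (a b c : A) (α β γ : B) : f (a ⊗ₜ (b * eps γ * c) ⊗ₜ (α * β)) =
    f ((a * eps α * b) ⊗ₜ c ⊗ₜ (β * γ)) + f ((c * eps β * a) ⊗ₜ b ⊗ₜ (α * γ)).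
  apply/esym/eqP; rewrite -subr_eq0 addrAC -d1E f0; exact/eqP.
split=> [a b α β|α]; apply: lin_ext => x.
  rewrite linDE !dual_actE !curryE.
  have := f1 x a b α β 1; rewrite rmorph1 !mulr1 => ->.
  by rewrite -[x * _ * _]mulrA [eps α * a]commT [_ * x]commT.
rewrite linDE !curryE.
by have := f1 x 1 1 1 1 α; rewrite rmorph1 !mulr1 !mul1r => ->.
Qed.

Lemma uncurry_cocycle (D : {linear B ⊗ A -> dual A}) :
  secondary_derivation D -> d1 T (uncurry D) = 0.
Proof.
case=> Dmul Deps.
pose F (x a : A) (α : B) : k^o := (D (α ⊗ₜ a) : {linear A -> k^o}) x.
have Fmul x a b α β : F x (a * b) (α * β) =
    F (x * (a * eps α)) b β + F (x * (b * eps β)) a α.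
  by rewrite /F Dmul linDE !dual_actE.
have Feps x α : F x (eps α) 1 = F x 1 α + F x 1 α by rewrite /F -Deps linDE.
apply: trilinear2_ext => a b c α β γ; rewrite d1E !uncurryE lin0E -!/(F _ _ _).
(* Leibniz for (γ ⊗ 1)(δ ⊗ y); it serves both outer terms of ∂^1, where δ is β or α. *)
have FB x y δ : F x y (δ * γ) = F (x * eps γ) y δ + F (x * (y * eps δ)) 1 γ.
  by rewrite mulB_comm -[in LHS](mul1r y) Fmul mul1r.
(* The middle term is [D] of (αβ ⊗ bc)(1 ⊗ ε(γ)). Leibniz splits it, [Fmul] splits αβ ⊗ bc again,
   and [Feps] doubles the remaining term. *)
have -> : F a (b * eps γ * c) (α * β) =
    F (a * eps γ * (b * eps α)) c β + F (a * eps γ * (c * eps β)) b α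
    + (F (a * (b * c * eps (α * β))) 1 γ + F (a * (b * c * eps (α * β))) 1 γ).
  rewrite -Fmul -Feps -[b * _ * c]mulrA [eps γ * c]commT [b * (c * _)]mulrA.
  by rewrite -[α * β in LHS]mulr1 Fmul rmorph1 mulr1 addrC.
rewrite !FB rmorphM /=.
have mulAC (x y z : A) : x * y * z = x * z * y by rewrite -!mulrA [y * z]commT.
(* By commutativity the outer terms take the arguments of the middle one. Their two γ ⊗ 1 parts
   become equal and cancel the doubled term. *)
have -> : a * eps α * b * eps γ = a * eps γ * (b * eps α).
  by rewrite mulrA !(mulAC a _ b) mulAC.
have -> : c * eps β * a * eps γ = a * eps γ * (c * eps β).
  by rewrite [c * _ * a]commT mulAC.
have -> : a * eps α * b * (c * eps β) = a * (b * c * (eps α * eps β)).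
  by rewrite !mulrA !(mulAC _ (eps α)).
have -> : c * eps β * a * (b * eps α) = a * (b * c * (eps α * eps β)).
  by rewrite [c * _ * a]commT !mulrA !(mulAC _ (eps β)) (mulAC a c).
by rewrite addrAC addrACA subrr.
Qed.
End Currying.

Theorem corollary3p7 (k : fieldType) (T : triple k)
    (char0 : [pchar k] =i pred0) (commT : commutative_triple T) :
  exists phi : {linear HC1 T -> Der1 T}, bijective phi.
Proof.
(* [Der1] is a subspace of the subspace [Der], so [curry] is corestricted twice: the cocycle
   condition gives the first step, cyclicity the second. *)
have curry_Der (f : cyclic_cocycles1 T) : Der_subspace (dual (algA T))
    ((curry T \o incl) f : {linear _ -> _}).
  have [_ f0] := inclP f; exact: curry_secondary_derivation.
pose toDer : {linear cyclic_cocycles1 T -> Der (dual (algA T))} :=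
  corestrict curry_Der.
have toDerE f : Der_fun (toDer f) = curry T (incl f) by exact: incl_corestrict.
have toDer_Der1 f : Der1_subspace T (toDer f).
  move=> a b α; rewrite toDerE !curryE.
  by have [/cyc1_fixedP fN _] := inclP f; exact: fN.
pose toDer1 : {linear cyclic_cocycles1 T -> Der1 T} := corestrict toDer_Der1.
have toDer1E f : incl (toDer1 f) = toDer f by exact: incl_corestrict.
have toDer1_cob f : cyclic_coboundary1 T f -> toDer1 f = 0.
  move=> [h fh]; suff -> : f = 0 by rewrite linear0.
  by apply: incl_inj; rewrite fh d0_comm // linear0.
exists (quotient_lift toDer1_cob); apply: quotient_lift_bij => [f g fg|D].
  apply: incl_inj; apply: (@curry_inj k T).
  by rewrite -!toDerE -!toDer1E fg.
have DD := inclP (incl D).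
(* The preimage of [D] is its uncurried form; antisymmetry of [D] makes it cyclic. *)
have [|f fD] := @incl_surj _ _ (cyclic_cocycle1 T) (uncurry (Der_fun (incl D))).
  split; last exact: uncurry_cocycle.
  by apply/cyc1_fixedP => a b α; rewrite !uncurryE; exact: (inclP D).
exists f; apply: incl_inj; rewrite toDer1E; apply: incl_inj.
by rewrite -[LHS]/(Der_fun (toDer f)) toDerE fD uncurryK.
Qed.
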